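(* Let $\mathcal{A}\in\mathbb{R}^{\ell\times p\times n}$, suppose that $m\le\min\{\ell,p\}$ steps of the tensor Lanczos bidiagonalization algorithm have been applied to $\mathcal{A}$ with $\mathcal{B}_m$ invertible, and let $k\in\{1,\dots,m-1\}$. Assume that $$\mathcal{A}\star\check{\mathcal{P}}_{k+1}=\check{\mathcal{Q}}_{k+1}\star\check{\mathcal{B}}_{k+1},\qquad \mathcal{A}^H\star\check{\mathcal{Q}}_{k+1}=\check{\mathcal{P}}_{k+1}\star\check{\mathcal{B}}_{k+1}^H+\check{\bm{\beta}}_{k+1}\star\vec{\check{\mathcal{P}}}_{k+2}\star\vec{\mathcal{E}}_{k+1}^H,$$ where $\check{\mathcal{P}}_{k+1}\in\mathbb{R}^{p\times(k+1)\times n}$ and $\check{\mathcal{Q}}_{k+1}\in\mathbb{R}^{\ell\times(k+1)\times n}$ have orthonormal lateral slices, $\check{\mathcal{B}}_{k+1}\in\mathbb{R}^{(k+1)\times(k+1)\times n}$ is upper triangular, the first $k$ lateral slices of $\check{\mathcal{P}}_{k+1}$ are t-linear combinations of the first $k$ harmonic Ritz lateral slices of $\mathcal{A}$, $\vec{\check{\mathcal{P}}}_{k+2}\in\mathbb{R}^{p\times1\times n}$ is orthogonal to $\check{\mathcal{P}}_{k+1}$, and the tube $\check{\bm{\beta}}_{k+1}$ is nonvanishing. Then there exist $\check{\mathcal{P}}_m\in\mathbb{R}^{p\times m\times n}$ and $\check{\mathcal{Q}}_m\in\mathbb{R}^{\ell\times m\times n}$ with orthonormal lateral slices, an upper triangular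 tensor $\check{\mathcal{B}}_m\in\mathbb{R}^{m\times m\times n}$, a tube $\check{\bm{\beta}}_m\in\mathbb{R}^{1\times1\times n}$ and a lateral slice $\vec{\check{\mathcal{P}}}_{m+1}\in\mathbb{R}^{p\times1\times n}$ orthogonal to all lateral slices of $\check{\mathcal{P}}_m$ such that $$\mathcal{A}\star\check{\mathcal{P}}_m=\check{\mathcal{Q}}_m\star\check{\mathcal{B}}_m,\qquad \mathcal{A}^H\star\check{\mathcal{Q}}_m=\check{\mathcal{P}}_m\star\check{\mathcal{B}}_m^H+\check{\bm{\beta}}_m\star\vec{\check{\mathcal{P}}}_{m+1}\star\vec{\mathcal{E}}_m^H,$$ and such that the first $k$ lateral slices of $\check{\mathcal{P}}_m$ and $\check{\mathcal{Q}}_m$ are the same as the first $k$ lateral slices of $\check{\mathcal{P}}_{k+1}$ and $\check{\mathcal{Q}}_{k+1}$, respectively.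
   Context: Third-order real tensors $\mathcal{A}\in\mathbb{R}^{\ell\times p\times n}$ have frontal slices $\mathcal{A}^{(k)}=\mathcal{A}(:,:,k)$. Elements of $\mathbb{R}^{\ell\times 1\times n}$ are called lateral slices and elements of $\mathbb{R}^{1\times1\times n}$ are called tubes. $\widehat{\mathcal{A}}$ denotes the tensor obtained by applying the (unnormalized) discrete Fourier transform of length $n$ to each tube $\mathcal{A}(i,j,:)$. The t-product $\mathcal{C}=\mathcal{A}\star\mathcal{B}$ of $\mathcal{A}\in\mathbb{R}^{\ell\times q\times n}$ and $\mathcal{B}\in\mathbb{R}^{q\times p\times n}$ is the tensor in $\mathbb{R}^{\ell\times p\times n}$ with $\widehat{\mathcal{C}}^{(i)}=\widehat{\mathcal{A}}^{(i)}\widehat{\mathcal{B}}^{(i)}$, $i=1,\dots,n$. The product of a tensor and a tube $\bm b$ multiplies each $\widehat{\mathcal{A}}^{(i)}$ by the scalar $\widehat{\bm b}^{(i)}$, and $\bm b\star\mathcal{A}=\mathcal{A}\star\bm b$. The transpose $\mathcal{A}^H$ is obtained by transposing all frontal slices and reversing the order of slices $2,\dots,n$ (so the frontal slices of $\widehat{\mathcal{A}^H}$ are the conjugate transposes of those of $\widehat{\mathcal{A}}$). The identity tensor $\mathcal{I}_m$ has first frontal slice $I_m$ and the others zero; $\mathcal{B}\in\mathbb{R}^{m\times m\times n}$ is invertible if some $\mathcal{B}^{-1}$ satisfies $\mathcal{B}\star\mathcal{B}^{-1}=\mathcal{B}^{-1}\star\mathcal{B}=\mathcal{I}_m$. $\vec{\mathcal{E}}_j\in\mathbb{R}^{j\times1\times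 n}$ (canonical lateral slice) has all entries zero except the first entry of its $j$th tube, which is $1$. Lateral slices $\vec{\mathcal{X}},\vec{\mathcal{Y}}$ are orthogonal if $\vec{\mathcal{X}}^H\star\vec{\mathcal{Y}}=0$; a tensor $\mathcal{X}$ with $j$ lateral slices has orthonormal lateral slices iff $\mathcal{X}^H\star\mathcal{X}=\mathcal{I}_j$. A t-linear combination of lateral slices $\vec{\mathcal{X}}_1,\dots,\vec{\mathcal{X}}_k$ is $\sum_{i=1}^k\vec{\mathcal{X}}_i\star\bm b_i$ with tubes $\bm b_i$. A tensor is upper triangular if its tubes $(i,j)$ with $i>j$ vanish. A tube is nonvanishing if it is not the zero tube. Output of $m$ steps of tensor Lanczos bidiagonalization (run without breakdown): $\mathcal{P}_m\in\mathbb{R}^{p\times m\times n}$ and $\mathcal{Q}_m\in\mathbb{R}^{\ell\times m\times n}$ with orthonormal lateral slices, $\vec{\mathcal{R}}_m\in\mathbb{R}^{p\times1\times n}$ with $\mathcal{P}_m^H\star\vec{\mathcal{R}}_m=0$, and $\mathcal{B}_m\in\mathbb{R}^{m\times m\times n}$ upper bidiagonal (only the tubes $(i,i)$ and $(i,i+1)$ may be nonzero), with $\mathcal{A}\star\mathcal{P}_m=\mathcal{Q}_m\star\mathcal{B}_m$ and $\mathcal{A}^H\star\mathcal{Q}_m=\mathcal{P}_m\star\mathcal{B}_m^H+\vec{\mathcal{R}}_m\star\vec{\mathcal{E}}_m^H$. The tube $\bm{\beta}_m$ is defined by $\widehat{\bm{\beta}}_m^{(i)}=\|\widehat{\vec{\mathcal{R}}}_m^{(i)}\|_2$,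 and $\mathcal{B}_{m,m+1}=[\mathcal{B}_m,\ \bm{\beta}_m\star\vec{\mathcal{E}}_m]\in\mathbb{R}^{m\times(m+1)\times n}$ is $\mathcal{B}_m$ with one lateral slice appended. Harmonic Ritz lateral slices (for $\mathcal{B}_m$ invertible): let $\{\bm s_i',\vec{\mathcal{U}}_i',\vec{\mathcal{V}}_i'\}_{i=1}^m$ be the singular triplets of $\mathcal{B}_{m,m+1}$ obtained from a t-SVD (i.e. real tensors whose Fourier-domain frontal slices give a matrix SVD of each $\widehat{\mathcal{B}}_{m,m+1}^{(i)}$, with nonnegative singular values), ordered so that the smallest come first (in each Fourier component the singular values are nondecreasing in the index). The $j$th harmonic Ritz lateral slice of $\mathcal{A}$ is $\vec{\check{\mathcal{V}}}_j=\mathcal{P}_m\star\mathcal{B}_m^{-1}\star\vec{\mathcal{U}}_j'$. *)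

(* Defs.v *)
From HB Require Import structures.
From mathcomp Require Import all_boot all_order all_algebra.
From mathcomp Require Import complex.
From mathcomp Require Import reals trigo.

Set Implicit Arguments.
Unset Strict Implicit.
Unset Printing Implicit Defensive.

Import Order.TTheory GRing.Theory Num.Theory.
Local Open Scope ring_scope.
Local Open Scope complex_scope.
Local Open Scope sesquilinear_scope.

(* Slices and Fourier components are indexed from 0.  [tensor R l p n] is the
   type of l x p x n tensors, as the family of their n frontal slices.  The
   number of frontal slices is at least 1, and is written n.+1 wherever index
   arithmetic modulo the number of slices is needed ('I_n.+1 is Z/(n+1)).  *)
Notation tensor R l p n := {ffun 'I_n -> 'M[R]_(l, p)}.

Section Fourier.
Variable R : realType.

Definition omega (n : nat) : R[i] :=
  cos (2 * pi / n%:R) -i* sin (2 * pi / n%:R).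

Definition dft l p n (A : tensor R l p n) : tensor R[i] l p n :=
  [ffun i : 'I_n =>
    \sum_(j < n) omega n ^+ (i * j) *: map_mx (real_complex R) (A j)].

(* The real part discards nothing on conjugate-symmetric families, which are
   exactly the transforms of real tensors: see [dftK] and [idftK].  *)
Definition idft l p n (F : tensor R[i] l p n) : tensor R l p n :=
  [ffun j : 'I_n =>
    map_mx (@complex.Re R)
      (n%:R^-1 *: \sum_(i < n) omega n ^- (i * j) *: F i)].

Definition conj_symmetric l p n (F : tensor R[i] l p n.+1) :=
  forall i : 'I_n.+1, F (- i) = map_mx Num.conj (F i).

End Fourier.

Section Tensors.
Variables (R : realType).

Definition tmul l q p n (A : tensor R l q n) (B : tensor R q p n) :
    tensor R l p n :=
  idft [ffun i => dft A i *m dft B i].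

Definition tscale l p n (b : tensor R 1 1 n) (A : tensor R l p n) :
    tensor R l p n :=
  idft [ffun i => dft b i 0 0 *: dft A i].

Definition ttr l p n (A : tensor R l p n.+1) : tensor R p l n.+1 :=
  [ffun k : 'I_n.+1 => (A (- k))^T].

Definition tid m n : tensor R m m n.+1 :=
  [ffun k : 'I_n.+1 => if k == 0 then 1%:M else 0].

Definition tlat l p n (A : tensor R l p n) (j : 'I_p) : tensor R l 1 n :=
  [ffun k => col j (A k)].

Definition ttube l p n (A : tensor R l p n) (i : 'I_l) (j : 'I_p) :
    tensor R 1 1 n :=
  [ffun k => (A k i j)%:M].

Definition tappend l p n (A : tensor R l p n) (X : tensor R l 1 n) :
    tensor R l (p + 1) n :=
  [ffun k => row_mx (A k) (X k)].

(* The canonical lateral slice with a unit tube in its last (j-th) place. *)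
Definition tlast j n : tensor R j 1 n.+1 :=
  [ffun k : 'I_n.+1 => \col_(i < j) ((i.+1 == j) && (k == 0))%:R].

(* The tube of the Euclidean norms of the Fourier components of X. *)
Definition tnorm l n (X : tensor R l 1 n) : tensor R 1 1 n :=
  idft [ffun i => (sqrtC (\sum_(r < l) `|dft X i r 0| ^+ 2))%:M].

End Tensors.

Notation "A '*t' B" := (tmul A B) (at level 40, left associativity).
Notation "b '*:t' A" := (tscale b A) (at level 40, left associativity).
Notation "A '^tH'" := (ttr A) (at level 2, left associativity, format "A ^tH").

Section Predicates.
Variables (R : realType).

Definition tinverse m n (B C : tensor R m m n.+1) :=
  B *t C = tid R m n /\ C *t B = tid R m n.

Definition torthogonal l n (X Y : tensor R l 1 n.+1) := X^tH *t Y = 0.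

Definition torthonormal l m n (X : tensor R l m n.+1) :=
  X^tH *t X = tid R m n.

Definition tupper m n (B : tensor R m m n) :=
  forall i j : 'I_m, (j < i)%N -> ttube B i j = 0.

Definition tbidiagonal m n (B : tensor R m m n) :=
  forall i j : 'I_m, j <> i :> nat -> j <> i.+1 :> nat -> ttube B i j = 0.

(* X is a t-linear combination of the slices Y j, j satisfying S. *)
Definition tlincomb l m n (S : pred 'I_m) (Y : 'I_m -> tensor R l 1 n)
    (X : tensor R l 1 n) :=
  exists b : 'I_m -> tensor R 1 1 n, X = \sum_(j < m | S j) b j *:t Y j.

(* A singular value decomposition M = U S V^H, with the singular values in
   nondecreasing order; in R[i], 0 <= z implies that z is real.  *)
Record is_svd m q (M : 'M[R[i]]_(m, q))
    (U : 'M[R[i]]_m) (S : 'M[R[i]]_(m, q)) (V : 'M[R[i]]_q) : Prop := {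
  svd_eq : M = U *m S *m V^t*;
  svd_unitaryl : U \is unitarymx;
  svd_unitaryr : V \is unitarymx;
  svd_diag : forall (i : 'I_m) (j : 'I_q), i <> j :> nat -> S i j = 0;
  svd_ge0 : forall (i : 'I_m) (j : 'I_q), i = j :> nat -> 0 <= S i j;
  svd_sorted : forall (i i' : 'I_m) (j j' : 'I_q),
    i = j :> nat -> i' = j' :> nat -> (i <= i')%N -> S i j <= S i' j' }.

Definition is_tsvd m q n (B : tensor R m q n)
    (U : tensor R m m n) (S : tensor R m q n) (V : tensor R q q n) :=
  forall i, is_svd (dft B i) (dft U i) (dft S i) (dft V i).

Record tlanczos l p m n (A : tensor R l p n.+1) (P : tensor R p m n.+1)
    (Q : tensor R l m n.+1) (B : tensor R m m n.+1) (r : tensor R p 1 n.+1) :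
    Prop := {
  tlanczos_P : torthonormal P;
  tlanczos_Q : torthonormal Q;
  tlanczos_r : P^tH *t r = 0;
  tlanczos_B : tbidiagonal B;
  tlanczos_AP : A *t P = Q *t B;
  tlanczos_AQ : A^tH *t Q = P *t B^tH + r *t (tlast R m n)^tH }.

(* B_{m,m+1} = [B_m, beta_m * E_m] *)
Definition tlanczos_ext m p n (B : tensor R m m n.+1)
    (r : tensor R p 1 n.+1) : tensor R m (m + 1) n.+1 :=
  tappend B (tnorm r *:t tlast R m n).

(* Binv is the inverse of B_m; U holds the left singular slices of B_{m,m+1}. *)
Definition harmonic_ritz p m n (P : tensor R p m n.+1)
    (Binv U : tensor R m m n.+1) (j : 'I_m) : tensor R p 1 n.+1 :=
  P *t Binv *t tlat U j.

End Predicates.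

(* The lemmas below check that the transforms of the objects defined through
   [idft] are the intended ones, so that the real parts lose nothing.  *)
Section Checks.
Variable R : realType.
Implicit Types (l p q n : nat).

Local Notation w n := (omega R n).

Lemma omegaX n k : w n ^+ k =
  cos (2 * pi / n%:R * k%:R) -i* sin (2 * pi / n%:R * k%:R).
Proof.
elim: k => [|k IH]; first by rewrite expr0 mulr0 cos0 sin0 oppr0.
have aD : 2 * pi / n%:R * k.+1%:R
    = 2 * pi / n%:R + 2 * pi / n%:R * k%:R :> R.
  by rewrite -[k.+1]add1n natrD mulrDr mulr1.
rewrite exprS IH aD cosD sinD /omega.
set c := cos _; set s := sin _; set c' := cos _; set s' := sin _.
apply/eqP; rewrite eq_complex /=; apply/andP; split; apply/eqP.
  by rewrite mulrNN [c * _]mulrC [s * _]mulrC.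
by rewrite mulrN mulNr -opprD addrC.
Qed.

Lemma omega_prim n : n.+1.-primitive_root (w n.+1).
Proof.
have n0 : n.+1%:R != 0 :> R by rewrite pnatr_eq0.
apply/andP; split=> //; apply/forallP => i; rewrite unity_rootE omegaX.
apply/eqP; case: (eqVneq i.+1 n.+1) => [->|neq].
  rewrite divfK // [2 * _]mulrC mulr_natr cos2pi sin2pi oppr0.
  by apply/eqP.
apply/negbTE; rewrite eq_complex /= negb_and.
have lt_in : (i.+1 < n.+1)%N by rewrite ltn_neqAle neq ltn_ord.
pose t : R := pi / n.+1%:R * i.+1%:R.
have -> : 2 * pi / n.+1%:R * i.+1%:R = t *+ 2.
  by rewrite /t -[RHS]mulr_natl !mulrA.
have t0 : 0 < t by rewrite mulr_gt0 ?divr_gt0 ?pi_gt0 ?ltr0n.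
have tpi : t < pi.
  rewrite /t -mulrA gtr_pMr ?pi_gt0 // mulrC ltr_pdivrMr ?ltr0n //.
  by rewrite mul1r ltr_nat.
have s0 : 0 < sin t by apply: sin_gt0_pi; rewrite t0.
have -> : cos (t *+ 2) = 1 - sin t ^+ 2 *+ 2.
  by rewrite cos_mulr2n cos2sin2 mulrnBl addrAC mulr2n addrK.
rewrite -subr_eq0 addrAC subrr add0r oppr_eq0 mulrn_eq0 expf_eq0 /=.
by rewrite gt_eqF.
Qed.

Lemma omega_neq0 n : w n.+1 != 0.
Proof.
apply/eqP => w0; have := prim_expr_order (omega_prim n).
by move/eqP; rewrite w0 expr0n /= eq_sym oner_eq0.
Qed.

Lemma omega_conj n : (w n)^*%C = (w n)^-1.
Proof.
apply: esym; apply: mulr1_eq; apply/eqP; rewrite eq_complex /=.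
rewrite mulNr !opprK -!expr2 cos2Dsin2 eqxx /=.
by rewrite mulNr mulrC addrN eqxx.
Qed.

Lemma omegaX_conj n k : Num.conj (w n ^+ k) = w n ^- k.
Proof. by rewrite rmorphXn -exprVn; congr (_ ^+ _); exact: omega_conj. Qed.

Lemma omegaX_conjM n k (x : R) :
  Num.conj (w n ^+ k * x%:C) = w n ^- k * x%:C.
Proof. by rewrite rmorphM; congr (_ * _); [exact: omegaX_conj | exact: conjc_real]. Qed.

(* orthogonality of the characters of Z/(n+1) *)
Lemma omega_ortho n (i k : 'I_n.+1) :
  \sum_(j < n.+1) w n.+1 ^+ (i * j) * w n.+1 ^- (k * j)
    = if i == k then n.+1%:R else 0.
Proof.
have wX j : w n.+1 ^+ (i * j) * w n.+1 ^- (k * j)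
    = (w n.+1 ^+ i / w n.+1 ^+ k) ^+ j.
  by rewrite exprMn exprVn -!exprM.
under eq_bigr do rewrite wX.
have wk0 : w n.+1 ^+ k != 0 by rewrite expf_neq0 // omega_neq0.
case: eqVneq => [->|neq].
  rewrite divff // (eq_bigr (fun=> 1)) => [|j _]; last by rewrite expr1n.
  by rewrite sumr_const card_ord.
set x := _ / _.
have x1 : x - 1 != 0.
  rewrite subr_eq0 /x -(inj_eq (mulIf wk0)) divfK // mul1r.
  by rewrite (eq_prim_root_expr (omega_prim n)) !modn_small.
apply: (mulfI x1); rewrite mulr0 -subrX1 /x exprMn exprVn -!exprM.
by rewrite ![(_ * n.+1)%N]mulnC !exprM (prim_expr_order (omega_prim n)) !expr1n divr1 subrr.
Qed.

Lemma omega_opp n (i : 'I_n.+1) j : w n.+1 ^+ ((- i)%R * j) = w n.+1 ^- (i * j).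
Proof.
have wn := prim_expr_order (omega_prim n).
rewrite !exprM -exprVn; congr (_ ^+ _).
rewrite /= expr_mod //; apply: (mulIf (expf_neq0 i (omega_neq0 n))).
rewrite -exprD subnK; last by rewrite ltnW.
by rewrite wn mulVf ?expf_neq0 ?omega_neq0.
Qed.

Lemma dftK l p n (A : tensor R l p n.+1) : idft (dft A) = A.
Proof.
apply/ffunP => j; rewrite ffunE.
suff -> : \sum_(i < n.+1) w n.+1 ^- (i * j) *: dft A i
    = n.+1%:R *: map_mx (real_complex R) (A j).
  rewrite scalerA mulVf ?pnatr_eq0 // scale1r.
  by apply/matrixP => a b; rewrite !mxE.
under eq_bigr do rewrite ffunE scaler_sumr.
rewrite exchange_big (bigD1 j) //= [X in _ + X]big1 ?addr0 => [|k kj].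
  under eq_bigr do rewrite scalerA mulrC ![(_ * j)%N]mulnC.
  by rewrite -scaler_suml omega_ortho eqxx.
under eq_bigr do rewrite scalerA mulrC [(_ * k)%N]mulnC [(_ * j)%N]mulnC.
by rewrite -scaler_suml omega_ortho (negPf kj) scale0r.
Qed.

Lemma idftK l p n (F : tensor R[i] l p n.+1) :
  conj_symmetric F -> dft (idft F) = F.
Proof.
move=> Fsym; pose G (j : 'I_n.+1) :=
  n.+1%:R^-1 *: \sum_(i < n.+1) w n.+1 ^- (i * j) *: F i.
have Greal j : map_mx (real_complex R) (idft F j) = G j.
  rewrite ffunE -/(G j); apply/matrixP => a b; rewrite 2!mxE.
  suff Gc : Num.conj (G j a b) = G j a b.
    by apply: RRe_real; apply/CrealP.
  rewrite !mxE rmorphM /= rmorphV ?unitfE ?pnatr_eq0 // rmorph_nat.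
  congr (_ * _); rewrite !summxE rmorph_sum /=.
  rewrite (reindex_inj oppr_inj) /=; apply: eq_bigr => i _.
  rewrite !mxE Fsym !mxE rmorphM /= conjCK -omega_opp; congr (_ * _).
  by rewrite fmorphV /= [Num.conj _]omegaX_conj invrK.
apply/ffunP => i; rewrite ffunE.
under eq_bigr do rewrite Greal scalerA mulrC -scalerA scaler_sumr.
rewrite -scaler_sumr exchange_big (bigD1 i) //= [X in _ + X]big1 ?addr0 => [|k ki].
  under eq_bigr do rewrite scalerA.
  by rewrite -scaler_suml omega_ortho eqxx scalerA mulVf ?pnatr_eq0 // scale1r.
under eq_bigr do rewrite scalerA.
by rewrite -scaler_suml omega_ortho eq_sym (negPf ki) scale0r.
Qed.

Lemma dft_conj_symmetric l p n (A : tensor R l p n.+1) :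
  conj_symmetric (dft A).
Proof.
move=> i; rewrite !ffunE; apply/matrixP => a b.
rewrite !mxE !summxE rmorph_sum; apply: eq_bigr => j _.
by rewrite !mxE omega_opp; apply: esym; exact: omegaX_conjM.
Qed.

Lemma dft_tmul l q p n (A : tensor R l q n.+1) (B : tensor R q p n.+1) i :
  dft (A *t B) i = dft A i *m dft B i.
Proof.
rewrite idftK ?ffunE // => k.
by rewrite [LHS]ffunE [X in map_mx _ X]ffunE !dft_conj_symmetric map_mxM.
Qed.

Lemma dft_tscale l p n (b : tensor R 1 1 n.+1) (A : tensor R l p n.+1) i :
  dft (b *:t A) i = dft b i 0 0 *: dft A i.
Proof.
rewrite idftK ?ffunE // => k.
by rewrite [LHS]ffunE [X in map_mx _ X]ffunE !dft_conj_symmetric map_mxZ mxE.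
Qed.

Lemma dft_ttr l p n (A : tensor R l p n.+1) i : dft A^tH i = (dft A i)^t*.
Proof.
rewrite !ffunE (reindex_inj oppr_inj) /=; apply/matrixP => a b.
rewrite !mxE !summxE rmorph_sum; apply: eq_bigr => j _.
rewrite !ffunE opprK !mxE mulnC omega_opp mulnC.
by apply: esym; exact: omegaX_conjM.
Qed.

Lemma dft_tid m n i : dft (tid R m n) i = 1%:M.
Proof.
rewrite ffunE (bigD1 ord0) //= big1 => [|j j0].
  by rewrite ffunE eqxx muln0 expr0 scale1r addr0 map_mx1.
by rewrite ffunE (negPf j0) map_mx0 scaler0.
Qed.

Lemma dft_tnorm l n (X : tensor R l 1 n.+1) i :
  dft (tnorm X) i 0 0 = sqrtC (\sum_(r < l) `|dft X i r 0| ^+ 2).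
Proof.
rewrite idftK ?ffunE ?mxE ?eqxx // => k.
rewrite [LHS]ffunE [X in map_mx _ X]ffunE map_scalar_mx /=; congr (_%:M).
under eq_bigr do rewrite dft_conj_symmetric mxE norm_conjC.
by rewrite geC0_conj // sqrtC_ge0 sumr_ge0 // => r _; rewrite exprn_ge0.
Qed.

End Checks.

(* Main.v *)
(* The decomposition of length k + 1 is already a partial Lanczos bidiagonalization,
   and continuing the Lanczos process from it yields the one of length m.
   A step from length j to j + 1 writes the residual as f = u * b with u a unit
   slice orthogonal to P_j; then w = A * u - Q_j * E_j * b^H is orthogonal to
   Q_j, and is written w = q * a in the same way.  The new columns are u and q,
   the new last column of B is (E_j * b^H, a), and the new residual is
   A^H * q - u * a^H.  A Fourier component in which f or w vanishes is no
   obstacle: any unit vector orthogonal to the previous columns will do there,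
   and one exists because j < min(l, p).  *)
Require Import Defs.
From mathcomp Require Import all_boot all_order all_algebra.
From mathcomp Require Import complex.
From mathcomp Require Import reals.

Import Order.TTheory GRing.Theory Num.Theory.
Local Open Scope ring_scope.
Local Open Scope sesquilinear_scope.

(** * Complex matrices: unit columns and one step of the Lanczos process *)

Section ConjugateTranspose.
Variable C : numClosedFieldType.
Set Implicit Arguments.
Unset Strict Implicit.

Lemma trmxC_mul m n q (X : 'M[C]_(m, n)) (Y : 'M_(n, q)) :
  (X *m Y)^t* = Y^t* *m X^t*.
Proof. by rewrite trmx_mul map_mxM. Qed.

Lemma trmxC_add m n (X Y : 'M[C]_(m, n)) : (X + Y)^t* = X^t* + Y^t*.
Proof. by rewrite linearD /= map_mxD. Qed.

Lemma trmxC_scale m n a (X : 'M[C]_(m, n)) : (a *: X)^t* = a^* *: X^t*.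
Proof. by apply/matrixP => i j; rewrite !mxE rmorphM. Qed.

Lemma trmxC_conj m n (X : 'M[C]_(m, n)) :
  (map_mx Num.conj X)^t* = map_mx Num.conj (X^t* ).
Proof. by rewrite map_trmx. Qed.

Lemma sqr_norm_colE p (f : 'cV[C]_p) :
  (f^t* *m f) 0 0 = \sum_(r < p) `|f r 0| ^+ 2.
Proof. by rewrite mxE; apply: eq_bigr => r _; rewrite !mxE normCK mulrC. Qed.

Lemma sqr_norm_col_ge0 p (f : 'cV[C]_p) : 0 <= (f^t* *m f) 0 0.
Proof. by rewrite sqr_norm_colE sumr_ge0 // => r _; rewrite exprn_ge0. Qed.

Lemma sqr_norm_col_eq0 p (f : 'cV[C]_p) : ((f^t* *m f) 0 0 == 0) = (f == 0).
Proof.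
apply/idP/eqP => [|->]; last by rewrite mulmx0 mxE.
rewrite sqr_norm_colE psumr_eq0 => [/allP f0|r _]; last by rewrite exprn_ge0.
apply/matrixP => r j; rewrite ord1 mxE; apply/eqP.
by have := f0 r (mem_index_enum r); rewrite expf_eq0 /= normr_eq0.
Qed.

Definition norm_col p (f : 'cV[C]_p) : C := sqrtC ((f^t* *m f) 0 0).

(** It sends [0] to [0], so that [normalizeK] holds for every [f]. *)
Definition normalize p (f : 'cV[C]_p) : 'cV[C]_p := (norm_col f)^-1 *: f.

Lemma norm_col_ge0 p (f : 'cV[C]_p) : 0 <= norm_col f.
Proof. by rewrite sqrtC_ge0 sqr_norm_col_ge0. Qed.

Lemma norm_col_eq0 p (f : 'cV[C]_p) : (norm_col f == 0) = (f == 0).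
Proof. by rewrite sqrtC_eq0 sqr_norm_col_eq0. Qed.

Lemma normalizeK p (f : 'cV[C]_p) : norm_col f *: normalize f = f.
Proof.
have [->|f0] := eqVneq f 0; first by rewrite /normalize !scaler0.
by rewrite scalerA mulfV ?scale1r // norm_col_eq0.
Qed.

Lemma normalize_unit p (f : 'cV[C]_p) :
  f != 0 -> (normalize f)^t* *m normalize f = 1%:M.
Proof.
move=> f0; have nf0 : norm_col f != 0 by rewrite norm_col_eq0.
apply/matrixP => a b; rewrite !ord1 /normalize trmxC_scale -scalemxAl.
rewrite -scalemxAr scalerA !mxE /=.
rewrite geC0_conj ?invr_ge0 ?norm_col_ge0 // -invfM -expr2 sqrtCK.
have := sqr_norm_col_eq0 f; rewrite (negPf f0) mxE => /negbT.
exact: mulVf.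
Qed.

Lemma normalize_conj p (f : 'cV[C]_p) :
  normalize (map_mx Num.conj f) = map_mx Num.conj (normalize f).
Proof.
rewrite /normalize map_mxZ fmorphV; congr (_^-1 *: _).
rewrite /= geC0_conj ?norm_col_ge0 // /norm_col; congr sqrtC.
rewrite !sqr_norm_colE.
by apply: eq_bigr => r _; rewrite mxE norm_conjC.
Qed.

(* The rule by which the vector is picked when f = 0 commutes with complex
   conjugation, so that on the Fourier components of real tensors it defines a
   real tensor.  *)
Definition next_col p j (X : 'M[C]_(p, j)) (f : 'cV[C]_p) : 'cV[C]_p :=
  let Y := 1%:M - X *m X^t* in
  normalize (if f != 0 then f else
    if [pick t | col t Y != 0] is Some t then col t Y else 0).

Lemma next_col_conj p j (X : 'M[C]_(p, j)) (f : 'cV[C]_p) :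
  next_col (map_mx Num.conj X) (map_mx Num.conj f)
    = map_mx Num.conj (next_col X f).
Proof.
have conj0 q (g : 'cV[C]_q) : (map_mx Num.conj g == 0) = (g == 0).
  by rewrite map_mx_eq0.
pose Y := 1%:M - X *m X^t*.
have YC : 1%:M - map_mx Num.conj X *m (map_mx Num.conj X)^t* = map_mx Num.conj Y.
  by rewrite trmxC_conj -map_mxM map_mxB map_mx1.
rewrite /next_col YC -/Y -normalize_conj conj0; congr normalize.
case: (f != 0) => //=.
have colC t : col t (map_mx Num.conj Y) = map_mx Num.conj (col t Y).
  by rewrite map_col.
(* Conjugation preserves which columns vanish, so [pick] returns the same index on both sides. *)
rewrite (@eq_pick _ _ (fun t => col t Y != 0)) => [|t]; last by rewrite colC conj0.
by case: pickP => [t _|_]; rewrite ?colC ?map_mx0.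
Qed.

(** [1 - X X^H] projects onto the orthogonal complement of the range of [X], so a nonzero column of
    it serves when [f = 0]; otherwise the direction of [f] does. Either way [f] is a multiple of the
    chosen unit vector [u], with coefficient [u^H f]. *)
Lemma next_colP p j (X : 'M[C]_(p, j)) (f : 'cV[C]_p) :
    X^t* *m X = 1%:M -> X^t* *m f = 0 -> (j < p)%N ->
  [/\ (next_col X f)^t* *m next_col X f = 1%:M,
      X^t* *m next_col X f = 0
    & f = next_col X f *m ((next_col X f)^t* *m f)].
Proof.
move=> XX Xf ltjp; rewrite /next_col; set Y := 1%:M - _.
have XY : X^t* *m Y = 0 by rewrite mulmxBr mulmx1 mulmxA XX mul1mx subrr.
have [f0|f0] := eqVneq f 0; rewrite /=; last first.
  split; first exact: normalize_unit.
    by rewrite -scalemxAr Xf scaler0.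
  have -> : (normalize f)^t* *m f = (norm_col f)%:M.
    by rewrite -{2}[f]normalizeK -scalemxAr normalize_unit // scalemx1.
  by rewrite mul_mx_scalar normalizeK.
case: pickP => [t Yt0|Y0]; rewrite ?f0 ?mulmx0; last first.
  (* If every column of [Y] vanished, [X X^H] would be the identity, of rank [p], while its rank is
     at most [j < p]. *)
  have Yz : Y = 0.
    apply/matrixP => a t; have /negbFE/eqP/matrixP/(_ a 0) := Y0 t.
    by rewrite !mxE.
  have := mxrankM_maxl X (X^t* ); move/subr0_eq: Yz => <-.
  by rewrite mxrank1 => /leq_trans/(_ (rank_leq_col _)); rewrite leqNgt ltjp.
split; [exact: normalize_unit | | by []].
by rewrite -scalemxAr colE mulmxA XY mul0mx scaler0.
Qed.

(** The new residual [f'] is orthogonal to [P] because [(A P)^H q = B^H Q^H q = 0], and to [u]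
    because [A u = Q e b^H + q a] gives [u^H A^H q = a^H]. *)
Lemma bidiag_step l p j (A : 'M[C]_(l, p)) (P : 'M[C]_(p, j))
    (Q : 'M[C]_(l, j)) (B : 'M[C]_j) (e : 'cV[C]_j) (f u : 'cV[C]_p)
    (q : 'cV[C]_l) (a b : 'M[C]_1) :
    Q^t* *m Q = 1%:M -> P^t* *m f = 0 ->
    A *m P = Q *m B -> A^t* *m Q = P *m B^t* + f *m e^t* ->
    u^t* *m u = 1%:M -> P^t* *m u = 0 -> f = u *m b ->
    q^t* *m q = 1%:M -> Q^t* *m q = 0 ->
    A *m u - Q *m (e *m b^t* ) = q *m a ->
    let B' := block_mx B (e *m b^t* ) 0 a in
    let f' := A^t* *m q - u *m a^t* in
  [/\ A *m row_mx P u = row_mx Q q *m B',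
      A^t* *m row_mx Q q = row_mx P u *m B'^t* + f' *m (col_mx 0 1%:M)^t*
    & (row_mx P u)^t* *m f' = 0].
Proof.
move=> QQ Pf AP AQ uu Pu fu qq Qq Auq B' f'.
have trB' : B'^t* = block_mx (B^t* ) 0 (b *m e^t* ) (a^t* ).
  by rewrite tr_block_mx map_block_mx trmxC_mul trmxCK trmx0 map_mx0.
have Auw : A *m u = Q *m (e *m b^t* ) + q *m a by rewrite -Auq addrC subrK.
have Ptf : P^t* *m f' = 0.
  rewrite mulmxBr !mulmxA -trmxC_mul AP trmxC_mul -[_ *m q]mulmxA Qq mulmx0.
  by rewrite Pu mul0mx subrr.
have utf : u^t* *m f' = 0.
  rewrite mulmxBr !mulmxA -trmxC_mul Auw trmxC_add !trmxC_mul mulmxDl.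
  by rewrite -!mulmxA Qq qq !mulmx0 add0r mulmxA uu mul1mx mulmx1 subrr.
split.
- by rewrite mul_mx_row mul_row_block mulmx0 addr0 -Auw AP.
(* In the first [j] columns, [f = u b] turns [u b e^H] back into the old residual term [f e^H]; in
   the last column [u a^H] cancels. *)
- rewrite trB' tr_col_mx map_row_mx trmx0 map_mx0 trmx1 map_mx1.
  rewrite !mul_mx_row mul_row_block !mulmx0 mulmx1 add0r add_row_mx addr0.
  by rewrite mulmxA -fu -AQ addrC subrK.
by rewrite tr_row_mx map_col_mx mul_col_mx Ptf utf col_mx0.
Qed.

(** The adjoint of the relation for [A^H Q] gives [Q^H A u = e f^H u = e b^H], so the subtraction
    removes exactly the component of [A u] along [Q]. *)
Lemma bidiag_residual_orth l p j (A : 'M[C]_(l, p)) (P : 'M[C]_(p, j))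
    (Q : 'M[C]_(l, j)) (B : 'M[C]_j) (e : 'cV[C]_j) (f u : 'cV[C]_p)
    (b : 'M[C]_1) :
    Q^t* *m Q = 1%:M -> A^t* *m Q = P *m B^t* + f *m e^t* ->
    u^t* *m u = 1%:M -> P^t* *m u = 0 -> f = u *m b ->
  Q^t* *m (A *m u - Q *m (e *m b^t* )) = 0.
Proof.
move=> QQ AQ uu Pu fu.
have QA : Q^t* *m A = B *m P^t* + e *m f^t*.
  by rewrite -[A in LHS]trmxCK -trmxC_mul AQ trmxC_add !trmxC_mul !trmxCK.
rewrite mulmxBr !mulmxA QQ mul1mx QA mulmxDl -!mulmxA Pu mulmx0 add0r.
by rewrite fu trmxC_mul -mulmxA uu mulmx1 subrr.
Qed.

Lemma row_mx_orthonormal l j (X : 'M[C]_(l, j)) (u : 'cV[C]_l) :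
    X^t* *m X = 1%:M -> X^t* *m u = 0 -> u^t* *m u = 1%:M ->
  (row_mx X u)^t* *m row_mx X u = 1%:M.
Proof.
move=> XX Xu uu; rewrite tr_row_mx map_col_mx mul_col_row XX Xu uu.
have -> : u^t* *m X = 0 by rewrite -[X]trmxCK -trmxC_mul Xu trmx0 map_mx0.
by rewrite -scalar_mx_block.
Qed.

End ConjugateTranspose.

(** * Real tensors: transfer from the Fourier components and extension of a decomposition *)

Section TensorBidiagonalization.
Variable R : realType.
Set Implicit Arguments.
Unset Strict Implicit.
Local Open Scope complex_scope.

(** Tensor identities thereby reduce to matrix identities, one Fourier component at a time. *)
Lemma dft_inj l p n (X Y : tensor R l p n.+1) :
  (forall i, dft X i = dft Y i) -> X = Y.
Proof. by move=> XY; rewrite -[X]dftK -[Y]dftK; congr idft; apply/ffunP. Qed.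

Lemma dftD l p n (X Y : tensor R l p n.+1) i :
  dft (X + Y) i = dft X i + dft Y i.
Proof.
rewrite !ffunE -big_split /=; apply: eq_bigr => j _.
by rewrite ffunE map_mxD scalerDr.
Qed.

Lemma dftB l p n (X Y : tensor R l p n.+1) i :
  dft (X - Y) i = dft X i - dft Y i.
Proof.
rewrite dftD; congr (_ + _); rewrite !ffunE -sumrN; apply: eq_bigr => j _.
by rewrite ffunE map_mxN scalerN.
Qed.

Lemma dft0 l p n i : dft (0 : tensor R l p n.+1) i = 0.
Proof.
by rewrite ffunE big1 // => j _; rewrite ffunE map_mx0 scaler0.
Qed.

Lemma dft_tlast j n i : dft (tlast R j n) i = \col_(r < j) (r.+1 == j)%:R.
Proof.
rewrite ffunE (bigD1 ord0) //= big1 => [|k k0]; last first.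
  apply/matrixP => a b; rewrite ffunE !mxE (negPf k0) andbF.
  by rewrite rmorph0 mulr0.
apply/matrixP => a b; rewrite ffunE !mxE eqxx andbT muln0 expr0 mul1r addr0.
by rewrite rmorph_nat.
Qed.

Lemma dft_tappend l p n (X : tensor R l p n.+1) (Y : tensor R l 1 n.+1) i :
  dft (tappend X Y) i = row_mx (dft X i) (dft Y i).
Proof.
apply/matrixP => a b; rewrite -[b]splitK; case: (split b) => c /=;
  rewrite ?row_mxEl ?row_mxEr !ffunE !summxE;
  by apply: eq_bigr => k _;
     rewrite ffunE map_row_mx scale_row_mx ?row_mxEl ?row_mxEr.
Qed.

Lemma tlat_tappend l p n (X : tensor R l p n.+1) (Y : tensor R l 1 n.+1)
    (j : 'I_(p + 1)) (j' : 'I_p) :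
  j = j' :> nat -> tlat (tappend X Y) j = tlat X j'.
Proof.
move=> jj'; apply/ffunP => i; rewrite !ffunE; apply/matrixP => a b.
rewrite !mxE; case: splitP => c; rewrite jj'.
  by move/val_inj ->.
by move=> E; have := ltn_ord j'; rewrite E ltnNge leq_addr.
Qed.

Lemma ttr_mul_eq0P l p q n (X : tensor R l p n.+1) (Y : tensor R l q n.+1) :
  (forall i, (dft X i)^t* *m dft Y i = 0) <-> X^tH *t Y = 0.
Proof.
split=> [XY|XY i]; first by apply: dft_inj => i; rewrite dft_tmul dft_ttr XY dft0.
by rewrite -dft_ttr -dft_tmul XY dft0.
Qed.

Lemma torthonormalP l m n (X : tensor R l m n.+1) :
  torthonormal X <-> (forall i, (dft X i)^t* *m dft X i = 1%:M).
Proof.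
split=> [XX i|XX]; first by rewrite -dft_ttr -dft_tmul XX dft_tid.
by apply: dft_inj => i; rewrite dft_tmul dft_ttr XX dft_tid.
Qed.

(** [next_col] is applied in each Fourier component; as it commutes with conjugation, the resulting
    family is the transform of a real tensor. The tube [b] is [u^H f], which may vanish in some
    components. *)
Lemma next_slice l j n (X : tensor R l j n.+1) (f : tensor R l 1 n.+1) :
    torthonormal X -> X^tH *t f = 0 -> (j < l)%N ->
  exists (u : tensor R l 1 n.+1) (b : tensor R 1 1 n.+1),
    [/\ torthonormal u, X^tH *t u = 0 & f = u *t b].
Proof.
move=> /torthonormalP XX /ttr_mul_eq0P Xf ltjl.
pose F : tensor R[i] l 1 n.+1 := [ffun i => next_col (dft X i) (dft f i)].
have FE i : dft (idft F) i = next_col (dft X i) (dft f i).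
  rewrite idftK ?ffunE // => k.
  by rewrite [LHS]ffunE [X in map_mx _ X]ffunE !dft_conj_symmetric next_col_conj.
have uP i := next_colP (XX i) (Xf i) ltjl.
exists (idft F), ((idft F)^tH *t f); split.
- by apply/torthonormalP => i; rewrite FE; case: (uP i).
- by apply/ttr_mul_eq0P => i; rewrite FE; case: (uP i).
apply: dft_inj => i; rewrite (dft_tmul (idft F)) (dft_tmul (idft F)^tH).
by rewrite (dft_ttr (idft F)) FE; case: (uP i).
Qed.

Lemma dft_tlat l p n (X : tensor R l p n.+1) j i :
  dft (tlat X j) i = col j (dft X i).
Proof.
apply/matrixP => a b; rewrite mxE !ffunE !summxE.
by apply: eq_bigr => k _; rewrite ffunE !mxE.
Qed.

(** Links the slicewise orthogonality of the theorem to the single product used in the recurrence: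
    row [c] of [X^H f] comes from slice [c]. *)
Lemma torthogonal_tlatP l j n (X : tensor R l j n.+1) (f : tensor R l 1 n.+1) :
  (forall c, torthogonal (tlat X c) f) <-> X^tH *t f = 0.
Proof.
have colE c i : (dft (tlat X c) i)^t* *m dft f i
    = row c ((dft X i)^t* *m dft f i).
  by rewrite dft_tlat row_mul; congr (_ *m _); apply/matrixP => a b; rewrite !mxE.
split=> [Xf|/ttr_mul_eq0P Xf c].
  apply/ttr_mul_eq0P => i; apply/row_matrixP => c.
  by have /ttr_mul_eq0P/(_ i) := Xf c; rewrite colE row0.
by apply/ttr_mul_eq0P => i; rewrite colE Xf row0.
Qed.

(** [f] stands for the whole product of the residual tube and slice. Left unnormalized, it may
    vanish in some Fourier components. *)
Definition bidiagonalization l p j n (A : tensor R l p n.+1)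
    (P : tensor R p j n.+1) (Q : tensor R l j n.+1) (B : tensor R j j n.+1)
    (f : tensor R p 1 n.+1) :=
  [/\ torthonormal P, torthonormal Q, tupper B, P^tH *t f = 0
    & A *t P = Q *t B /\ A^tH *t Q = P *t B^tH + f *t (tlast R j n)^tH].

Definition tblock_upper j n (B : tensor R j j n) (X : tensor R j 1 n)
    (a : tensor R 1 1 n) : tensor R (j + 1) (j + 1) n :=
  [ffun k => block_mx (B k) (X k) 0 (a k)].

Lemma dft_tblock_upper j n (B : tensor R j j n.+1) (X : tensor R j 1 n.+1)
    (a : tensor R 1 1 n.+1) i :
  dft (tblock_upper B X a) i = block_mx (dft B i) (dft X i) 0 (dft a i).
Proof.
rewrite -[in RHS](dft0 1 j i); apply/matrixP => a' b.
rewrite -[a']splitK -[b]splitK; case: (split a') (split b) => c [] d /=;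
  rewrite ?block_mxEul ?block_mxEur ?block_mxEdl ?block_mxEdr !ffunE !summxE;
  by apply: eq_bigr => k _; rewrite ?ffunE map_block_mx scale_block_mx
     ?block_mxEul ?block_mxEur ?block_mxEdl ?block_mxEdr.
Qed.

Lemma tupperP j n (B : tensor R j j n) :
  tupper B <-> forall (k : 'I_n) (a b : 'I_j), (b < a)%N -> B k a b = 0.
Proof.
split=> [uB k a b /uB /ffunP/(_ k)/matrixP/(_ 0 0)|uB a b ba].
  by rewrite !ffunE !mxE mulr1n.
by apply/ffunP => k; rewrite !ffunE uB // raddf0.
Qed.

Lemma tupper_tblock_upper j n (B : tensor R j j n) (X : tensor R j 1 n)
    (a : tensor R 1 1 n) : tupper B -> tupper (tblock_upper B X a).
Proof.
move/tupperP => uB; apply/tupperP => k c d; rewrite ffunE !mxE.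
case: splitP => c' ->; rewrite !mxE; case: splitP => d' -> //.
- exact: uB.
- by move=> dc; have := ltn_ord c'; rewrite ltnNge (leq_trans _ (ltnW dc)) ?leq_addr.
- by rewrite mxE.
by rewrite (ord1 c') (ord1 d') ltnn.
Qed.

Lemma torthonormal_tappend l j n (X : tensor R l j n.+1)
    (u : tensor R l 1 n.+1) :
    torthonormal X -> torthonormal u -> X^tH *t u = 0 ->
  torthonormal (tappend X u).
Proof.
move=> /torthonormalP XX /torthonormalP uu /ttr_mul_eq0P Xu.
by apply/torthonormalP => i; rewrite dft_tappend; apply: row_mx_orthonormal.
Qed.

Lemma bidiagonalization_extend l p j n (A : tensor R l p n.+1)
    (P : tensor R p j n.+1) (Q : tensor R l j n.+1) (B : tensor R j j n.+1)
    (f : tensor R p 1 n.+1) :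
    bidiagonalization A P Q B f -> (j < l)%N -> (j < p)%N ->
  exists u q B' f', bidiagonalization A (tappend P u) (tappend Q q) B' f'.
Proof.
case=> oP oQ uB Pf [AP AQ] ltjl ltjp.
have [u [b [ou Pu fu]]] := next_slice oP Pf ltjp.
(* [e b^H] equals [Q^H A u], so [w] is the part of [A u] orthogonal to [Q]. *)
pose e := tlast R j n; pose w := A *t u - Q *t (e *t b^tH).
have AQi i : (dft A i)^t* *m dft Q i
    = dft P i *m (dft B i)^t* + dft f i *m (dft e i)^t*.
  by rewrite -!dft_ttr -!dft_tmul -dftD AQ.
have fui i : dft f i = dft u i *m dft b i by rewrite -dft_tmul fu.
have wE i : dft w i = dft A i *m dft u i - dft Q i *m (dft e i *m (dft b i)^t* ).
  apply: etrans (dftB _ _ i) _; congr (_ - _); first exact: dft_tmul.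
  apply: etrans (dft_tmul _ _ i) _; congr (_ *m _).
  by apply: etrans (dft_tmul _ _ i) _; congr (_ *m _); exact: dft_ttr.
have /torthonormalP oQi := oQ; have /ttr_mul_eq0P Pfi := Pf.
have /torthonormalP oui := ou; have /ttr_mul_eq0P Pui := Pu.
have Qw : Q^tH *t w = 0.
  apply/ttr_mul_eq0P => i; rewrite wE.
  exact: bidiag_residual_orth (oQi i) (AQi i) (oui i) (Pui i) (fui i).
have [q [a [oq Qq wq]]] := next_slice oQ Qw ltjl.
pose B' := tblock_upper B (e *t b^tH) a.
pose f' := A^tH *t q - u *t a^tH.
have B'E i : dft B' i
    = block_mx (dft B i) (dft e i *m (dft b i)^t* ) 0 (dft a i).
  apply: etrans (dft_tblock_upper _ _ _ i) _; congr block_mx.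
  by apply: etrans (dft_tmul _ _ i) _; congr (_ *m _); exact: dft_ttr.
have f'E i : dft f' i = (dft A i)^t* *m dft q i - dft u i *m (dft a i)^t*.
  apply: etrans (dftB _ _ i) _; congr (_ - _);
  by apply: etrans (dft_tmul _ _ i) _; congr (_ *m _); exact: dft_ttr.
have APi i : dft A i *m dft P i = dft Q i *m dft B i.
  by rewrite -!dft_tmul AP.
have wqi i : dft A i *m dft u i - dft Q i *m (dft e i *m (dft b i)^t* )
    = dft q i *m dft a i.
  by rewrite -wE -dft_tmul wq.
have /torthonormalP oqi := oq; have /ttr_mul_eq0P Qqi := Qq.
have step i := bidiag_step (oQi i) (Pfi i) (APi i) (AQi i) (oui i) (Pui i)
  (fui i) (oqi i) (Qqi i) (wqi i).
(* The unit entry has index [j], which is the appended row. *)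
have eE i : dft (tlast R (j + 1) n) i = col_mx 0 1%:M.
  rewrite dft_tlast; apply/matrixP => c d; rewrite !mxE ord1.
  case: splitP => c' ->; rewrite !mxE.
    by rewrite addn1 eqSS ltn_eqF.
  by rewrite !ord1 addn0 addn1 eqxx.
exists u, q, B', f'; split; try exact: torthonormal_tappend.
- exact: tupper_tblock_upper.
- apply/ttr_mul_eq0P => i; rewrite dft_tappend f'E.
  by case: (step i).
split; apply: dft_inj => i; have [s1 s2 _] := step i.
  apply: etrans (dft_tmul _ _ i) _; apply/esym.
  apply: etrans (dft_tmul _ _ i) _; apply/esym.
  by rewrite B'E (dft_tappend P) (dft_tappend Q).
apply: etrans (dft_tmul _ _ i) _; apply/esym.
apply: etrans (dftD _ _ i) _; apply/esym.
rewrite (dft_ttr A) (dft_tappend Q) s2; congr (_ + _); apply/esym.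
  apply: etrans (dft_tmul _ _ i) _; congr (_ *m _); first exact: dft_tappend.
  by apply: etrans (dft_ttr _ i) _; rewrite B'E.
apply: etrans (dft_tmul _ _ i) _; congr (_ *m _); first exact: f'E.
by apply: etrans (dft_ttr _ i) _; rewrite eE.
Qed.

(** Induction on the number [d] of added slices. The length is a variable [m] with an equation
    because [j + 0] and [j + d.+1] are not convertible to [j] and [(j + d) + 1], the sizes that
    actually arise. *)
Lemma bidiagonalization_extend_to l p j d m n (A : tensor R l p n.+1)
    (P : tensor R p j n.+1) (Q : tensor R l j n.+1) (B : tensor R j j n.+1)
    (f : tensor R p 1 n.+1) :
    bidiagonalization A P Q B f -> m = (j + d)%N -> (m <= minn l p)%N ->
  exists (P' : tensor R p m n.+1) (Q' : tensor R l m n.+1) B' f',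
    bidiagonalization A P' Q' B' f' /\
    (forall (i : 'I_m) (i' : 'I_j), i = i' :> nat ->
       tlat P' i = tlat P i' /\ tlat Q' i = tlat Q i').
Proof.
move=> bP; elim: d m => [|d IH] m; rewrite ?addn0 ?addnS.
  by move=> -> _; exists P, Q, B, f; split=> // i i' /val_inj ->.
rewrite -addn1 => -> lt; have [] := IH (j + d)%N erefl.
  by rewrite (leq_trans _ lt) // leq_addr.
move=> P' [Q' [B' [f' [bP' PQ']]]].
(* The new length [j + d + 1] is at most [minn l p], which gives the strict bounds that a step
   requires. *)
have /andP[ltl ltp] : (j + d < l)%N && (j + d < p)%N.
  by rewrite -leq_min -addn1.
have [u [q [B'' [f'' bP'']]]] := bidiagonalization_extend bP' ltl ltp.
exists (tappend P' u), (tappend Q' q), B'', f''; split=> // i i' ii'.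
have lti : (i < j + d)%N by rewrite ii' (leq_trans (ltn_ord i')) ?leq_addr.
have [<- <-] := PQ' (Ordinal lti) i' ii'.
by split; apply: tlat_tappend.
Qed.

End TensorBidiagonalization.

Theorem theorem12 (R : realType) (l p n m k : nat)
    (A : tensor R l p n.+1)
    (hm : (m <= minn l p)%N)
    (* m steps of tensor Lanczos bidiagonalization, with B_m invertible *)
    (P : tensor R p m n.+1) (Q : tensor R l m n.+1) (B : tensor R m m n.+1)
    (r : tensor R p 1 n.+1) (hL : tlanczos A P Q B r)
    (Binv : tensor R m m n.+1) (hBinv : tinverse B Binv)
    (* t-SVD of B_{m,m+1}, smallest singular values first *)
    (U : tensor R m m n.+1) (S : tensor R m (m + 1) n.+1)
    (V : tensor R (m + 1) (m + 1) n.+1)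
    (hsvd : is_tsvd (tlanczos_ext B r) U S V)
    (hk : (0 < k < m)%N)
    (* the decomposition of length k + 1 *)
    (Pk : tensor R p k.+1 n.+1) (Qk : tensor R l k.+1 n.+1)
    (Bk : tensor R k.+1 k.+1 n.+1) (betak : tensor R 1 1 n.+1)
    (pk : tensor R p 1 n.+1)
    (hAPk : A *t Pk = Qk *t Bk)
    (hAQk : A^tH *t Qk = Pk *t Bk^tH + betak *:t pk *t (tlast R k.+1 n)^tH)
    (hPk : torthonormal Pk) (hQk : torthonormal Qk) (hBk : tupper Bk)
    (hritz : forall i : 'I_k.+1, (i < k)%N ->
       tlincomb (fun j : 'I_m => (j < k)%N) (harmonic_ritz P Binv U)
         (tlat Pk i))
    (hpk : forall i : 'I_k.+1, torthogonal (tlat Pk i) pk)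
    (hbetak : betak <> 0) :
  exists (Pm : tensor R p m n.+1) (Qm : tensor R l m n.+1)
         (Bm : tensor R m m n.+1) (betam : tensor R 1 1 n.+1)
         (pm : tensor R p 1 n.+1),
    torthonormal Pm /\ torthonormal Qm /\ tupper Bm /\
    (forall i : 'I_m, torthogonal (tlat Pm i) pm) /\
    A *t Pm = Qm *t Bm /\
    A^tH *t Qm = Pm *t Bm^tH + betam *:t pm *t (tlast R m n)^tH /\
    (forall (i : 'I_m) (j : 'I_k.+1), i = j :> nat -> (j < k)%N ->
       tlat Pm i = tlat Pk j /\ tlat Qm i = tlat Qk j).
Proof.
have /andP[_ ltkm] := hk.
have /torthogonal_tlatP/ttr_mul_eq0P Pkpk := hpk.
have Pkf : Pk^tH *t (betak *:t pk) = 0.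
  apply/ttr_mul_eq0P => i.
  by rewrite (dft_tscale betak) -scalemxAr Pkpk scaler0.
have bPk : bidiagonalization A Pk Qk Bk (betak *:t pk).
  exact: And5 hPk hQk hBk Pkf (conj hAPk hAQk).
(* [m - (k + 1)] slices are appended; the first [k + 1] are kept, in particular the first [k]. *)
have [Pm [Qm [Bm [f [[oP oQ uB Pf [AP AQ]] eqPQ]]]]] :=
  bidiagonalization_extend_to bPk (esym (subnKC ltkm)) hm.
have tscale1 : tid R 1 n *:t f = f.
  apply: dft_inj => i; apply: etrans (dft_tscale _ _ i) _.
  by rewrite (@dft_tid R 1 n i) mxE scale1r.
(* The final residual [f] itself serves as the slice, and the identity tube, whose Fourier
   components are all [1], as the factor. *)
exists Pm, Qm, Bm, (tid R 1 n), f; rewrite tscale1.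
refine (conj oP (conj oQ (conj uB (conj _ (conj AP (conj AQ _)))))).
  exact/torthogonal_tlatP.
by move=> i j ij _; apply: eqPQ.
Qed.
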